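(* Let $F\in\mathcal{H}^d$ and let $A$ be its homogeneity matrix. If the spectral radius satisfies $\rho(A)<1$, then $F$ has a positive eigenvector $\mathbf{x}=(\mathbf{x}_1,\dots,\mathbf{x}_d)\in\mathcal{K}_{++}$, and it is the unique eigenvector of $F$ in $\mathcal{K}_{++}$ up to rescaling of each $\mathbf{x}_i$, $i\in[d]$, by a positive scalar.
   Context: Fix positive integers $d,n_1,\dots,n_d$ and write $[n]=\{1,\dots,n\}$. Let $V=\mathbb{R}^{n_1}\times\cdots\times\mathbb{R}^{n_d}$, $\mathcal{K}_+=\mathbb{R}^{n_1}_+\times\cdots\times\mathbb{R}^{n_d}_+$ (vectors with nonnegative entries), and let $\mathcal{K}_{++}$ be its interior (all entries positive). Elements are written $\mathbf{x}=(\mathbf{x}_1,\dots,\mathbf{x}_d)$ with $\mathbf{x}_i\in\mathbb{R}^{n_i}$. Write $\mathbf{x}\le_{\mathcal{K}}\mathbf{y}$ if $\mathbf{y}-\mathbf{x}\in\mathcal{K}_+$. For $\boldsymbol{\alpha}\in\mathbb{R}^d$, $\mathbf{x}\in V$ set $\boldsymbol{\alpha}\otimes\mathbf{x}=(\alpha_1\mathbf{x}_1,\dots,\alpha_d\mathbf{x}_d)$. For $\boldsymbol{\alpha}\in\mathbb{R}^d_+$ and a nonnegative $d\times d$ matrix $A$ set $\boldsymbol{\alpha}^A=(\prod_k\alpha_k^{A_{1,k}},\dots,\prod_k\alpha_k^{A_{d,k}})$ (with $0^0=1$). $\mathcal{H}^d$ is the set of continuous maps $F=(F_1,\dots,F_d):\mathcal{K}_+\to\mathcal{K}_+$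 such that: (i) there is a nonnegative $d\times d$ matrix $A$ (the homogeneity matrix of $F$) with $F(\boldsymbol{\alpha}\otimes\mathbf{x})=\boldsymbol{\alpha}^A\otimes F(\mathbf{x})$ for all $\boldsymbol{\alpha}\in\mathbb{R}^d_+$, $\mathbf{x}\in\mathcal{K}_+$; (ii) $F$ is order-preserving: $\mathbf{x}\le_{\mathcal{K}}\mathbf{y}$ implies $F(\mathbf{x})\le_{\mathcal{K}}F(\mathbf{y})$; (iii) $F$ is nondegenerate: $F(\mathcal{K}_{++})\subset\mathcal{K}_{++}$ and $A\mathbb{R}^d_{++}\subset\mathbb{R}^d_{++}$. An eigenvector of $F\in\mathcal{H}^d$ is $\mathbf{x}\in\mathcal{K}_+$ with $\mathbf{x}_i\ne0$ for every $i\in[d]$ and $F(\mathbf{x})=\boldsymbol{\lambda}\otimes\mathbf{x}$ for some $\boldsymbol{\lambda}\in\mathbb{R}^d_+$; it is positive if $\mathbf{x}\in\mathcal{K}_{++}$. *)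

(* Defs.v *)
From HB Require Import structures.
From mathcomp Require Import all_boot all_order all_algebra.
From mathcomp Require Import all_classical all_reals all_analysis.
From mathcomp.real_closed Require Import complex.
Set Implicit Arguments.
Unset Strict Implicit.
Unset Printing Implicit Defensive.
Import Order.TTheory GRing.Theory Num.Theory.
Import numFieldNormedType.Exports.
Local Open Scope classical_set_scope.
Local Open Scope ring_scope.

(* Entrywise nonnegative / positive vectors: R^m_+ and R^m_{++}. *)
Definition orthant (R : realType) (m : nat) : set 'cV[R]_m :=
  [set v | forall j, 0 <= v j 0].

Definition open_orthant (R : realType) (m : nat) : set 'cV[R]_m :=
  [set v | forall j, 0 < v j 0].

(* V = R^(n_1) x ... x R^(n_d), with the product topology. *)
Definition prodspace (R : realType) (d : nat) (n : 'I_d -> nat) :=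
  prod_topology (fun i : 'I_d => 'cV[R]_(n i)).

Definition Kplus (R : realType) (d : nat) (n : 'I_d -> nat) :
    set (prodspace R n) :=
  [set x | forall i, orthant (x i)].

Definition Kpp (R : realType) (d : nat) (n : 'I_d -> nat) :
    set (prodspace R n) :=
  [set x | forall i, open_orthant (x i)].

Definition leK (R : realType) (d : nat) (n : 'I_d -> nat)
    (x y : prodspace R n) : Prop :=
  Kplus (fun i => y i - x i : 'cV[R]_(n i)).

Definition bscale (R : realType) (d : nat) (n : 'I_d -> nat)
    (alpha : 'cV[R]_d) (x : prodspace R n) : prodspace R n :=
  fun i => alpha i 0 *: x i.

(* alpha^A; note that 0 `^ 0 = 1 and 0 `^ a = 0 for a != 0. *)
Definition vecpow (R : realType) (d : nat) (alpha : 'cV[R]_d) (A : 'M[R]_d) :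
    'cV[R]_d :=
  \col_i \prod_(k < d) (alpha k 0 `^ A i k).

(* [multihomog F A]: F belongs to H^d and A is its homogeneity matrix.  F is
   a total function on V, but only its values on K_+ are constrained. *)
Record multihomog (R : realType) (d : nat) (n : 'I_d -> nat)
    (F : prodspace R n -> prodspace R n) (A : 'M[R]_d) : Prop := Multihomog {
  mh_maps : forall x, Kplus x -> Kplus (F x);
  mh_continuous : {within @Kplus R d n, continuous F};
  mh_matrix_ge0 : forall i k, 0 <= A i k;
  mh_homogeneous : forall (alpha : 'cV[R]_d) (x : prodspace R n),
    orthant alpha -> Kplus x ->
    F (bscale alpha x) = bscale (vecpow alpha A) (F x);
  mh_order_preserving : forall x y, Kplus x -> Kplus y ->
    leK x y -> leK (F x) (F y);
  mh_Kpp : forall x, Kpp x -> Kpp (F x);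
  mh_matrix_pos : forall v : 'cV[R]_d, open_orthant v -> open_orthant (A *m v)
}.

Definition is_eigenvector (R : realType) (d : nat) (n : 'I_d -> nat)
    (F : prodspace R n -> prodspace R n) (x : prodspace R n) : Prop :=
  [/\ Kplus x, (forall i, x i != 0) &
      exists2 lambda : 'cV[R]_d, orthant lambda & F x = bscale lambda x].

(* Largest modulus of a complex eigenvalue; for 0 < d the set is finite and
   nonempty, so that the supremum is attained. *)
Definition spectral_radius (R : realType) (d : nat) (A : 'M[R]_d) : R :=
  sup [set r | exists2 z : complex R,
    eigenvalue (map_mx (real_complex R) A) z & r = ComplexField.Normc.normc z].

(* Main.v *)
(* In logarithmic coordinates [F] becomes an order-preserving map [G] with
   [G (u + a) = G u + A a], where [a] adds [a_i] to every entry of block [i].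
   Since [rho A < 1] there is [b > 0] with [b - A b = 1].  Translating by
   [t b] or [- t b] with [t] large gives a super- and a subsolution of
   [G u = u], hence a fixed point, and the decrease [A b < b] makes positive
   fixed points unique.  An eigenvector with eigenvalue [lambda] becomes a
   fixed point after rescaling its blocks by [exp a], where
   [(1 - A) a = ln lambda]. *)
Require Import Defs.
From mathcomp Require Import all_boot all_order all_algebra.
From mathcomp Require Import all_classical all_reals all_analysis.
From mathcomp.real_closed Require Import complex.
Set Implicit Arguments.
Unset Strict Implicit.
Unset Printing Implicit Defensive.
Import Order.TTheory GRing.Theory Num.Theory.
Import numFieldNormedType.Exports.
Local Open Scope ring_scope.

Lemma real_eigenvalue_le_spectral_radius (R : realType) (d : nat)
    (A : 'M[R]_d) (t : R) : eigenvalue A t -> `|t| <= spectral_radius A.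
Proof.
move=> At; apply: ub_le_sup; last first.
  exists (real_complex R t); first by rewrite eigenvalue_map.
  by rewrite /= expr0n /= addr0 sqrtr_sqr.
have [rs Ers] := closed_field_poly_normal (char_poly (map_mx (real_complex R) A)).
(* The supremum in [spectral_radius] dominates its members only if they are bounded; the sum of the
   moduli of all characteristic roots is a bound. *)
exists (\sum_(z <- rs) ComplexField.Normc.normc z) => _ [z zA ->].
have normc_ge0 (y : complex R) : 0 <= ComplexField.Normc.normc y.
  by case: y => a b /=; apply: sqrtr_ge0.
have zrs : z \in rs.
  move: zA; rewrite eigenvalue_root_char Ers (monicP (char_poly_monic _)) scale1r.
  by rewrite root_prod_XsubC.
by rewrite (big_rem z zrs) /= lerDl sumr_ge0.
Qed.

(** A kernel vector would make [s^-1], which is at least 1, an eigenvalue of [A]. *)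
Lemma det_1_sub_scale_neq0 (R : realType) (d : nat) (A : 'M[R]_d) (s : R) :
  spectral_radius A < 1 -> 0 <= s <= 1 -> \det (1%:M - s *: A) != 0.
Proof.
move=> rhoA /andP[s0 s1]; apply/negP => /det0P[v v0].
rewrite mulmxBr mulmx1 -scalemxAr => /eqP; rewrite subr_eq0 => /eqP Ev.
have sn0 : s != 0 by apply: contra_neq v0 => s_eq0; rewrite Ev s_eq0 scale0r.
have /real_eigenvalue_le_spectral_radius : eigenvalue A s^-1.
  by apply/eigenvalueP; exists v => //; rewrite {2}Ev scalerA mulVf // scale1r.
have s_gt0 : 0 < s by rewrite lt0r sn0.
rewrite ger0_norm ?invr_ge0 // => /le_lt_trans/(_ rhoA).
by rewrite invf_lt1 // ltNge s1.
Qed.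

Lemma continuous_bigmin (R : realType) (I : Type) (r : seq I) (f0 : R -> R)
    (f : I -> R -> R) : continuous f0 -> (forall i, continuous (f i)) ->
  continuous (fun x => \big[Order.min/f0 x]_(i <- r) f i x).
Proof.
move=> cf0 cf; elim: r => [|i r IHr].
  by under [X in continuous X]eq_fun do rewrite big_nil.
under [X in continuous X]eq_fun do rewrite big_cons.
by move=> x; apply: continuous_min; [exact: cf | exact: IHr].
Qed.

(* The solution of [b = 1 + s A b] exists for all [s] in [[0, 1]]; if it is
   nonnegative it is at least [1], so by continuity in [s] its least entry
   cannot leave the positive half line. *)
Lemma subinvariant_vector (R : realType) (d : nat) (A : 'M[R]_d) :
  (forall i k, 0 <= A i k) -> spectral_radius A < 1 ->
  exists2 b : 'cV[R]_d, open_orthant b & A *m b = b - const_mx 1.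
Proof.
move=> A0 rhoA.
(* Working over polynomials shows that the determinant and the adjugate of [M s] are polynomial,
   hence continuous, in [s]. *)
pose Mp : 'M[{poly R}]_d := 1%:M - 'X *: map_mx polyC A.
pose M s : 'M[R]_d := 1%:M - s *: A.
have MpE s : map_mx (horner_eval s) Mp = M s.
  apply/matrixP => i j; rewrite !mxE /horner_eval hornerD hornerN hornerM.
  by rewrite hornerX hornerC; case: eqP => _; rewrite ?hornerC ?mulr1n ?mulr0n ?hornerC.
pose one : 'cV[R]_d := const_mx 1.
(* Cramer's rule without the division: [q s] is [\det (M s)] times the desired solution, and is
   defined even before the determinant is known to be nonzero. *)
pose q s := \adj (M s) *m one.
have Mq s : M s *m q s = \det (M s) *: one.
  by rewrite mulmxA mul_mx_adj mul_scalar_mx.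
have qE s : q s = \det (M s) *: one + s *: (A *m q s).
  by rewrite -Mq mulmxBl mul1mx -scalemxAl subrK.
have detE s : \det (M s) = (\det Mp).[s] by rewrite -MpE det_map_mx.
have qpE i s : q s i 0 = (\sum_j (\adj Mp) i j).[s].
  rewrite mxE -MpE -map_mx_adj horner_sum; apply: eq_bigr => j _.
  by rewrite !mxE mulr1.
have pos s : 0 <= s -> 0 < \det (M s) -> (forall i, 0 <= q s i 0) ->
    forall i, 0 < q s i 0.
  move=> s0 D0 q0 i; rewrite qE !mxE mulr1 ltr_wpDr // mulr_ge0 //.
  by rewrite sumr_ge0 // => k _; rewrite mulr_ge0.
(* Starting the minimum at the determinant lets one sign control both the determinant and all
   entries of [q s]. *)
pose f s := \big[Order.min/ \det (M s)]_i q s i 0.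
have cf : continuous f.
  apply: (@continuous_bigmin R _ _ (fun s => \det (M s)) (fun i s => q s i 0)).
    by under [X in continuous X]eq_fun do rewrite detE; exact: continuous_horner.
  move=> i; under [X in continuous X]eq_fun do rewrite qpE.
  exact: continuous_horner.
(* At a zero of [f] the determinant is nonnegative and nonzero, and [q s] is nonnegative; [pos] then
   makes everything positive, so [f s] could not vanish. *)
have f_neq0 s : 0 <= s <= 1 -> f s != 0.
  move=> s01; apply/eqP => fs0; suff : 0 < f s by rewrite fs0 ltxx.
  have D0 : 0 < \det (M s).
    by rewrite lt0r det_1_sub_scale_neq0 //= -fs0 bigmin_le_id.
  apply: lt_bigmin => // i _; apply: pos => //; first by case/andP: s01.
  by move=> j; rewrite -fs0 bigmin_le.
have f0_gt0 : 0 < f 0.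
  have M0 : M 0 = 1%:M by rewrite /M scale0r subr0.
  apply: lt_bigmin => [|i _]; first by rewrite M0 det1.
  by rewrite qE scale0r addr0 M0 det1 scale1r mxE.
have f1_gt0 : 0 < f 1.
  rewrite ltNge; apply/negP => f1_le0.
  have [||c] := @IVT R f 0 1 0 ler01.
  - exact: continuous_subspaceT.
  - by rewrite ge_min f1_le0 orbT le_max (ltW f0_gt0).
  - by rewrite in_itv /= => c01 /eqP; rewrite (negPf (f_neq0 _ c01)).
have [D0 q0] : 0 < \det (M 1) /\ forall i, 0 < q 1 i 0.
  split; first exact: lt_le_trans f1_gt0 (bigmin_le_id _ _ _ _).
  by move=> i; exact: lt_le_trans f1_gt0 (bigmin_le _ _ _).
exists ((\det (M 1))^-1 *: q 1) => [i|].
  by rewrite mxE mulr_gt0 ?invr_gt0.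
rewrite -scalemxAr [in X in _ = X - _]qE scale1r scalerDr scalerA mulVf ?gt_eqF //.
by rewrite scale1r addrAC subrr add0r.
Qed.

Lemma leKP (R : realType) (d : nat) (n : 'I_d -> nat) (x y : prodspace R n) :
  leK x y <-> forall i j, x i j 0 <= y i j 0.
Proof.
by split=> xy i j; move: (xy i j); rewrite !mxE subr_ge0.
Qed.

(** In logarithmic coordinates a monomial map is linear; this turns homogeneity into the translation
    rule for [A]. *)
Lemma vecpow_expR (R : realType) (d : nat) (a : 'cV[R]_d) (A : 'M[R]_d) :
  vecpow (map_mx expR a) A = map_mx expR (A *m a).
Proof.
apply/matrixP => i j; rewrite !mxE expR_sum; apply: eq_bigr => k _.
by rewrite mxE mulrC expRM ord1.
Qed.

Lemma orthant_expR (R : realType) (d : nat) (a : 'cV[R]_d) :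
  orthant (map_mx expR a).
Proof. by move=> j; rewrite mxE expR_ge0. Qed.

Lemma Kpp_Kplus (R : realType) (d : nat) (n : 'I_d -> nat) (x : prodspace R n) :
  Kpp x -> Kplus x.
Proof. by move=> x0 i j; exact/ltW/x0. Qed.

Lemma prodspace_ext (R : realType) (d : nat) (n : 'I_d -> nat)
    (x y : prodspace R n) : (forall i j, x i j 0 = y i j 0) -> x = y.
Proof.
move=> xy; apply: (@boolp.functional_extensionality_dep _ _ x y) => i; apply/matrixP => j k.
by rewrite ord1.
Qed.

(* Apply [F] to [x <= exp (s b) y] with the least possible [s]: if [s] were
   positive, the strict decrease [A b < b] would improve on it. *)
Lemma fixed_points_leK (R : realType) (d : nat) (n : 'I_d -> nat)
    (F : prodspace R n -> prodspace R n) (A : 'M[R]_d) (b : 'cV[R]_d)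
    (x y : prodspace R n) : multihomog F A -> open_orthant b ->
  A *m b = b - const_mx 1 -> Kpp x -> Kpp y -> F x = x -> F y = y -> leK x y.
Proof.
move=> HF b0 Ab x0 y0 Fx Fy; apply/leKP => i j.
pose T := {i : 'I_d & 'I_(n i)}.
(* At entry [p], [g p] is the exponent giving equality in [x <= exp (s b) y], so the least
   admissible [s] is the maximum of [g]. *)
pose g (p : T) := ln (x (tag p) (tagged p) 0 / y (tag p) (tagged p) 0) / b (tag p) 0.
have [p _ p_max] := @arg_maxP _ R T (Tagged _ j) xpredT g isT.
set s := g p in p_max.
have ratio i' j' : x i' j' 0 = expR (g (Tagged _ j') * b i' 0) * y i' j' 0.
  rewrite /g /= divfK ?gt_eqF //.
  by rewrite lnK ?divfK ?posrE ?divr_gt0 ?gt_eqF ?x0 ?y0 //; (exact: x0 || exact: y0).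
have x_le i' j' : x i' j' 0 <= expR (s * b i' 0) * y i' j' 0.
  rewrite ratio ler_pM2r; last exact: y0.
  by rewrite ler_expR ler_pM2r; [exact: p_max | exact: b0].
have [s_le0|s_gt0] := leP s 0.
  apply: le_trans (x_le i j) _; rewrite ger_pMl; last exact: y0.
  by rewrite -expR0 ler_expR mulr_le0_ge0 //; exact/ltW/b0.
have y_ge0 := Kpp_Kplus y0.
have : leK (F x) (F (bscale (map_mx expR (s *: b)) y)).
  apply: (mh_order_preserving HF) => [||].
  - exact: Kpp_Kplus.
  - by move=> i' j'; rewrite /bscale !mxE mulr_ge0 ?expR_ge0 //; exact: y_ge0.
  - by apply/leKP => i' j'; rewrite /bscale !mxE.
rewrite (mh_homogeneous HF) //; last exact: orthant_expR.
(* The image inequality is [x <= exp (s b - s) y]; at the maximizing entry, where [x] equals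
   [exp (s b) y], it forces [s <= 0]. *)
rewrite Fx Fy vecpow_expR -scalemxAr Ab => /leKP/(_ (tag p) (tagged p)).
rewrite /bscale !mxE ratio ler_pM2r; last exact: y0.
rewrite ler_expR.
have -> : Tagged _ (tagged p) = p by case: (p).
rewrite -/s mulrBr mulr1 => /le_lt_trans.
by move=> /(_ (s * b (tag p) 0)); rewrite ltxx ltrBlDr ltrDl s_gt0 => /(_ isT).
Qed.

(* Knaster-Tarski: the entrywise supremum of the [x] with [x <= F x] in the
   order interval is fixed. *)
Lemma fixed_point_between (R : realType) (d : nat) (n : 'I_d -> nat)
    (F : prodspace R n -> prodspace R n) (u v : prodspace R n) :
  (forall x y, Kplus x -> Kplus y -> leK x y -> leK (F x) (F y)) ->
  Kplus v -> leK v u -> leK v (F v) -> leK (F u) u ->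
  exists x, leK v x /\ F x = x.
Proof.
move=> monoF v0 /leKP vu vFv /leKP Fuu.
have Kplus_ge x : leK v x -> Kplus x.
  by move=> /leKP vx i j; exact: le_trans (v0 i j) (vx i j).
pose S : set (prodspace R n) := [set x | [/\ leK v x, leK x u & leK x (F x)]]%classic.
pose E i j : set R := [set x i j 0 | x in S]%classic.
pose xs : prodspace R n := fun i => \col_j sup (E i j).
have xsE i j : xs i j 0 = sup (E i j) by rewrite mxE.
have Sv : S v by split=> //; exact/leKP.
have xs_ub x : S x -> leK x xs.
  move=> Sx; apply/leKP => i j; rewrite xsE; apply: ub_le_sup; last by exists x.
  by exists (u i j 0) => _ [y [_ /leKP yu _] <-].
have xs_least y : (forall x, S x -> leK x y) -> leK xs y.
  move=> Sy; apply/leKP => i j; rewrite xsE; apply: ge_sup.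
    by exists (v i j 0); exists v.
  by move=> _ [x Sx <-]; exact: (leKP _ _).1 (Sy x Sx) i j.
have leK_trans (y x z : prodspace R n) : leK x y -> leK y z -> leK x z.
  by move=> /leKP xy /leKP yz; apply/leKP => i j; exact: le_trans (xy i j) (yz i j).
have vxs : leK v xs by exact: xs_ub.
have xsu : leK xs u by apply: xs_least => x [].
have xsF : leK xs (F xs).
  apply: xs_least => x Sx; have [vx _ xFx] := Sx.
  by apply: leK_trans xFx _; apply: monoF; [exact: Kplus_ge.. | exact: xs_ub].
(* This and [Fxsu] put [F xs] itself in [S], hence below the supremum [xs]. *)
have FxsF : leK (F xs) (F (F xs)).
  by apply: monoF => //; apply: Kplus_ge => //; exact: leK_trans xsF.
have Fxsu : leK (F xs) u.
  apply: (leK_trans (F u)); last exact/leKP.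
  by apply: monoF => //; apply: Kplus_ge => //; exact/leKP.
have /leKP FxsX : leK (F xs) xs by apply: xs_ub; split=> //; exact: leK_trans xsF.
exists xs; split=> //; apply: prodspace_ext => i j; apply/eqP.
by rewrite eq_le FxsX; move/leKP: xsF => ->.
Qed.

Lemma positive_fixed_point (R : realType) (d : nat) (n : 'I_d -> nat)
    (F : prodspace R n -> prodspace R n) (A : 'M[R]_d) (b : 'cV[R]_d) :
  multihomog F A -> open_orthant b -> A *m b = b - const_mx 1 ->
  exists2 x, Kpp x & F x = x.
Proof.
move=> HF b0 Ab.
pose e : prodspace R n := fun=> const_mx 1.
have e0 : Kpp e by move=> i j; rewrite mxE.
have Fe0 := mh_Kpp HF e0.
(* Since [A b = b - 1], moving from 0 to [s b] lowers [G u - u] by [s] in every entry. Hence it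
   suffices that [t] bounds every entry of [G 0], the logarithm of [F e], in absolute value. *)
pose t : R := \sum_i \sum_(j < n i) `|ln (F e i j 0)|.
have t0 : 0 <= t by do 2![apply: sumr_ge0 => ? _].
have ln_le i j : `|ln (F e i j 0)| <= t.
  rewrite /t (bigD1 i) //= (bigD1 j) //= -addrA lerDl addr_ge0 ?sumr_ge0 //.
  by move=> ? _; apply: sumr_ge0.
have FeE i j : F e i j 0 = expR (ln (F e i j 0)) by rewrite lnK // posrE; exact: Fe0.
pose w s : prodspace R n := bscale (map_mx expR (s *: b)) e.
have wE s i j : w s i j 0 = expR (s * b i 0) by rewrite !mxE mulr1.
have w0 s : Kpp (w s) by move=> i j; rewrite wE expR_gt0.
have FwE s i j : F (w s) i j 0 = expR (s * b i 0 - s + ln (F e i j 0)).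
  rewrite (mh_homogeneous HF); [|exact: orthant_expR|exact: Kpp_Kplus].
  by rewrite vecpow_expR -scalemxAr Ab !mxE mulrBr mulr1 (expRD (_ - _)) -FeE.
have [|||||x [/leKP wx Fx]] := @fixed_point_between R d n F (w t) (w (- t)).
- exact: mh_order_preserving HF.
- exact: Kpp_Kplus.
- apply/leKP => i j; rewrite !wE ler_expR ler_pM2r; last exact: b0.
  by rewrite (le_trans _ t0) ?oppr_le0.
- apply/leKP => i j; rewrite wE FwE ler_expR opprK -addrA lerDl -lerBlDl sub0r.
  by rewrite lerNl; apply: le_trans (ln_le i j); rewrite -normrN ler_norm.
- apply/leKP => i j; rewrite wE FwE ler_expR -addrA gerDl addrC subr_le0.
  by apply: le_trans (ln_le i j); rewrite ler_norm.
by exists x => // i j; exact: lt_le_trans (w0 (- t) i j) (wx i j).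
Qed.

Theorem theorem3p1 (R : realType) (d : nat) (n : 'I_d -> nat)
    (d_gt0 : (0 < d)%N) (n_gt0 : forall i, (0 < n i)%N)
    (F : prodspace R n -> prodspace R n) (A : 'M[R]_d)
    (HF : multihomog F A) (rhoA : spectral_radius A < 1) :
  exists x : prodspace R n,
    [/\ is_eigenvector F x,
        Kpp x &
        forall y : prodspace R n, is_eigenvector F y -> Kpp y ->
          exists2 c : 'cV[R]_d, open_orthant c & y = bscale c x].
Proof.
have [b b0 Ab] := subinvariant_vector (mh_matrix_ge0 HF) rhoA.
have [x x0 Fx] := positive_fixed_point HF b0 Ab.
exists x; split=> //.
  split; first exact: Kpp_Kplus.
    move=> i; apply/eqP => xi0; move: (x0 i (Ordinal (n_gt0 i))).
    by rewrite xi0 mxE ltxx.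
  exists (const_mx 1) => [j|]; first by rewrite mxE.
  by rewrite Fx; apply: prodspace_ext => i j; rewrite !mxE mul1r.
move=> y [_ _ [l _ Fy]] y0.
(* Positivity, needed to take [ln l], is read off from one entry of each nonempty block. *)
have l0 i : 0 < l i 0.
  have Fy0 : Kpp (F y) := mh_Kpp HF y0.
  have := Fy0 i (Ordinal (n_gt0 i)).
  by rewrite Fy mxE pmulr_lgt0 //; exact: y0.
have uM : 1%:M - A \in unitmx.
  rewrite unitmxE unitfE -[A]scale1r det_1_sub_scale_neq0 //.
  by rewrite ler01 lexx.
(* Scaling [y] by [exp a] multiplies [F y] by [exp (A a)]; the choice of [a] makes
   [exp (A a) l = exp a], which absorbs the eigenvalue. *)
pose a := invmx (1%:M - A) *m map_mx (@ln R) l.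
have aE : a = A *m a + map_mx (@ln R) l.
  by rewrite -[map_mx (@ln R) l](mulKVmx uM) -/a mulmxBl mul1mx addrC subrK.
clearbody a.
pose z := bscale (map_mx expR a) y.
have z0 : Kpp z by move=> i j; rewrite /z !mxE mulr_gt0 ?expR_gt0 //; exact: y0.
have Fz : F z = z.
  rewrite (mh_homogeneous HF); [|exact: orthant_expR|exact: Kpp_Kplus].
  rewrite vecpow_expR Fy; apply: prodspace_ext => i j.
  by rewrite /z [in RHS]aE /bscale !mxE expRD lnK ?posrE // mulrA.
have zx : z = x.
  apply: prodspace_ext => i j; apply/eqP; rewrite eq_le.
  have /leKP -> := fixed_points_leK HF b0 Ab z0 x0 Fz Fx.
  by have /leKP -> := fixed_points_leK HF b0 Ab x0 z0 Fx Fz.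
exists (map_mx expR (- a)) => [j|]; first by rewrite mxE expR_gt0.
rewrite -zx; apply: prodspace_ext => i j.
by rewrite /z /bscale !mxE mulrA -expRD addNr expR0 mul1r.
Qed.
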